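(* Let $\phi=\frac{1+\sqrt5}{2}$ and let $\Gamma\subset SL_2(\mathbb R)$ be the group generated by $$\sigma_0=\begin{pmatrix}1&\phi\\0&1\end{pmatrix},\quad \sigma_1=\begin{pmatrix}\phi&\phi\\1&\phi\end{pmatrix},\quad \sigma_2=\begin{pmatrix}\phi&1\\\phi&\phi\end{pmatrix},\quad \sigma_3=\begin{pmatrix}1&0\\\phi&1\end{pmatrix}.$$ Let $S=\{\gamma\binom{1}{0}:\gamma\in\Gamma\}\subset\mathbb R^2$. There exist a sequence of positive numbers $\epsilon_n\to 0$ and a constant $C>0$ such that for every $n$ there are three distinct points of $S$ lying on a horizontal line segment of length $\epsilon_n$, and these three points lie in the ball centered at the origin of radius $C\epsilon_n^{-4}$.
   Context: A horizontal line segment is a segment contained in a line $\{y=c\}$ in $\mathbb R^2$. Balls are with respect to the Euclidean norm. $\Gamma$ acts on $\mathbb R^2$ by matrix multiplication on column vectors. *)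

(* Defs.v *)
From HB Require Import structures.
From mathcomp Require Import all_boot all_order all_algebra.
From mathcomp Require Import all_classical all_reals all_analysis.
Set Implicit Arguments. Unset Strict Implicit. Unset Printing Implicit Defensive.
Import Order.TTheory GRing.Theory Num.Theory.
Local Open Scope ring_scope.

Section Defs.
Variable R : realType.

Definition phi : R := (1 + Num.sqrt 5) / 2.

Definition mx2 (a b c d : R) : 'M[R]_2 :=
  \matrix_(i < 2, j < 2) nth 0 (nth [::] [:: [:: a; b]; [:: c; d]] i) j.

Definition sigma (k : 'I_4) : 'M[R]_2 :=
  match val k with
  | 0 => mx2 1 phi 0 1
  | 1 => mx2 phi phi 1 phi
  | 2 => mx2 phi 1 phi phi
  | _ => mx2 1 0 phi 1
  end.

Inductive in_Gamma : 'M[R]_2 -> Prop :=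
  | Gamma_one : in_Gamma 1%:M
  | Gamma_mul (k : 'I_4) (g : 'M[R]_2) : in_Gamma g -> in_Gamma (sigma k *m g)
  | Gamma_mulV (k : 'I_4) (g : 'M[R]_2) :
      in_Gamma g -> in_Gamma (invmx (sigma k) *m g).

Definition pt (x y : R) : 'cV[R]_2 :=
  \col_(i < 2) nth 0 [:: x; y] i.

Definition xcoord (p : 'cV[R]_2) : R := p ord0 ord0.
Definition ycoord (p : 'cV[R]_2) : R := p (lift ord0 ord0) ord0.

Definition in_S (p : 'cV[R]_2) : Prop :=
  exists g, in_Gamma g /\ p = g *m pt 1 0.

Definition on_hseg (a c len : R) (p : 'cV[R]_2) : Prop :=
  ycoord p = c /\ a <= xcoord p <= a + len.

Definition enorm (p : 'cV[R]_2) : R :=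
  Num.sqrt (xcoord p ^+ 2 + ycoord p ^+ 2).

Definition in_ball0 (r : R) (p : 'cV[R]_2) : Prop := enorm p < r.

End Defs.

(* Main.v *)
Require Import Defs.
From HB Require Import structures.
From mathcomp Require Import all_boot all_order all_algebra.
From mathcomp Require Import all_classical all_reals all_analysis.
From mathcomp Require Import ring lra zify.
Import Order.TTheory GRing.Theory Num.Theory.
Import numFieldNormedType.Exports.
Local Open Scope classical_set_scope.
Local Open Scope ring_scope.

(** A line in direction [w], where [u *: w] is in S for a large [u], becomes
    horizontal under an element of Gamma, which divides lengths along [w] by [u].
    So it suffices to have three points of S on a line of direction [(a, 1)],
    at mutual distances of order [a], where [u *: (a, 1)] is in S.

    For every natural [a], the points [(-(2a+1)phi, 1)], [(-a phi^2 - phi, phi)]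
    and [(-phi, phi^3)] are in S; their differences are [(phi - 1)(a, 1)] and
    [2 phi (a, 1)]. With [a = F_2n] a Fibonacci number, [phi^(n^2) (a, 1)] is in
    S, by induction on [n] from [phi^k = F_k phi + F_(k-1)] and its conjugate.
    The triple then has length [eps = 2 phi / phi^(n^2)] and height at most
    [12 phi^(2 n^2)], since [F_2n <= phi^(2n)]; a horizontal shear of Gamma
    makes its abscissas comparable to its height. *)

Fixpoint fib (n : nat) : nat :=
  if n is m.+1 then if m is l.+1 then (fib m + fib l)%N else 1%N else 0%N.

Lemma fibSS n : fib n.+2 = (fib n.+1 + fib n)%N.
Proof. by []. Qed.

Section GoldenOrbit.
Variable R : realType.
Implicit Types (x y z : R) (p q : 'cV[R]_2) (g : 'M[R]_2).
Local Notation phi := (phi R).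
Local Notation in_S := (@in_S R).

(** * The golden ratio: bounds and quadratic equation *)

Lemma phi_gt1 : 1 < phi.
Proof.
have h : Num.sqrt 1 < Num.sqrt 5 :> R by rewrite ltr_sqrt; lra.
by rewrite sqrtr1 in h; rewrite /Defs.phi; lra.
Qed.

Lemma phi_lt2 : phi < 2.
Proof.
have h : Num.sqrt 5 < Num.sqrt (3 ^+ 2) :> R by rewrite ltr_sqrt; lra.
by rewrite sqrtr_sqr ger0_norm // in h; rewrite /Defs.phi; lra.
Qed.

Lemma phi_gt0 : 0 < phi.
Proof. exact: lt_trans phi_gt1. Qed.

Lemma phi_sqr : phi ^+ 2 = phi + 1.
Proof.
have h : Num.sqrt 5 ^+ 2 = 5 :> R by rewrite sqr_sqrtr.
by rewrite /Defs.phi expr_div_n sqrrD h; field.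
Qed.

(** * Coordinates and determinants in the plane *)

Lemma mx2_eta g : g = mx2 (g 0 0) (g 0 1) (g 1 0) (g 1 1).
Proof.
apply/matrixP => i j; rewrite mxE.
by case: i => [[|[|]]] // hi; case: j => [[|[|]]] //= hj;
  congr (g _ _); apply/val_inj.
Qed.

Lemma det_mx2 (a b c d : R) : \det (mx2 a b c d) = a * d - b * c.
Proof.
rewrite (expand_det_row _ ord0) !big_ord_recl big_ord0 /cofactor !det_mx11.
by rewrite !mxE /= addr0 expr0 mul1r expr1 mulN1r mulrN.
Qed.

Lemma pt_coords p : pt (xcoord p) (ycoord p) = p.
Proof.
apply/matrixP => i j; rewrite mxE ord1; case: i => [[|[|]]] //= h;
  by congr (p _ _); apply/val_inj.
Qed.

Lemma xcoord_pt x y : xcoord (pt x y) = x.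
Proof. by rewrite /xcoord mxE. Qed.

Lemma ycoord_pt x y : ycoord (pt x y) = y.
Proof. by rewrite /ycoord mxE. Qed.

Lemma mulmx_mx2_pt (a b c d x y : R) :
  mx2 a b c d *m pt x y = pt (a * x + b * y) (c * x + d * y).
Proof.
apply/matrixP => i j; rewrite !mxE !big_ord_recl big_ord0 !mxE /= addr0.
by case: i => [[|[|]]].
Qed.

(** This is the determinant with columns [p] and [q]; pairing [pt 1 0] with [q] extracts the
    ordinate of [q]. *)
Definition wedge p q : R := xcoord p * ycoord q - ycoord p * xcoord q.

Lemma wedge_mulmx g p q : wedge (g *m p) (g *m q) = \det g * wedge p q.
Proof.
rewrite -(pt_coords p) -(pt_coords q) (mx2_eta g) det_mx2 !mulmx_mx2_pt.
by rewrite /wedge !xcoord_pt !ycoord_pt; ring.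
Qed.

(** * The action of Gamma on S *)

Lemma det_sigma k : \det (sigma R k) = 1.
Proof.
by have := phi_sqr; case: k => [[|[|[|[|]]]]] // h e;
  rewrite /sigma /= det_mx2; ring: e.
Qed.

Lemma sigma_unit k : sigma R k \in unitmx.
Proof. by rewrite unitmxE det_sigma unitr1. Qed.

Lemma det_Gamma g : in_Gamma g -> \det g = 1.
Proof.
elim=> [|k h _ hd|k h _ hd]; first exact: det1.
- by rewrite det_mulmx det_sigma hd mulr1.
- by rewrite det_mulmx det_inv det_sigma hd invr1 mulr1.
Qed.

Lemma in_S_sigma k p : in_S p -> in_S (sigma R k *m p).
Proof.
move=> [g [gG ->]]; exists (sigma R k *m g); rewrite mulmxA.
by split=> //; exact: Gamma_mul.
Qed.

Lemma in_S_sigmaV k p : in_S (sigma R k *m p) -> in_S p.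
Proof.
move=> [g [gG e]]; exists (invmx (sigma R k) *m g).
by split; [exact: Gamma_mulV | rewrite -mulmxA -e mulKmx ?sigma_unit].
Qed.

(** By induction on the word [g]: its leftmost letter is undone inside S, then the rest of the
    word. *)
Lemma Gamma_preimage g q :
  in_Gamma g -> in_S q -> exists2 p, in_S p & g *m p = q.
Proof.
move=> gG; elim: gG q => [|k h _ IH|k h _ IH] q qS.
- by exists q => //; rewrite mul1mx.
- have [|p pS e] := IH (invmx (sigma R k) *m q).
    by apply: (@in_S_sigmaV k); rewrite mulKVmx ?sigma_unit.
  by exists p => //; rewrite -mulmxA e mulKVmx ?sigma_unit.
- have [p pS e] := IH _ (in_S_sigma k _ qS).
  by exists p => //; rewrite -mulmxA e mulKmx ?sigma_unit.
Qed.

Lemma Gamma_inj g : in_Gamma g -> injective (mulmx g : 'cV[R]_2 -> 'cV[R]_2).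
Proof.
move=> gG; apply: can_inj (mulKmx _).
by rewrite unitmxE det_Gamma // unitr1.
Qed.

Lemma in_S_e1 : in_S (pt 1 0).
Proof. by exists 1%:M; rewrite mul1mx; split=> //; exact: Gamma_one. Qed.

Lemma sigma0_pt x y : sigma R (inord 0) *m pt x y = pt (x + phi * y) y.
Proof. by rewrite /sigma /= inordK // mulmx_mx2_pt mul1r mul0r add0r mul1r. Qed.

Lemma sigma1_pt x y :
  sigma R (inord 1) *m pt x y = pt (phi * x + phi * y) (x + phi * y).
Proof. by rewrite /sigma /= inordK // mulmx_mx2_pt mul1r. Qed.

Lemma sigma3_pt x y : sigma R (inord 3) *m pt x y = pt x (phi * x + y).
Proof. by rewrite /sigma /= inordK // mulmx_mx2_pt mul0r !mul1r addr0. Qed.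

(** These are the powers of [sigma_0]. Membership passes both ways through one shear, so a negative
    power is a positive one read backwards. *)
Lemma in_S_shear x y (m : int) :
  in_S (pt x y) <-> in_S (pt (x + m%:~R * (phi * y)) y).
Proof.
have step z : in_S (pt z y) <-> in_S (pt (z + phi * y) y).
  by rewrite -sigma0_pt; split; [exact: in_S_sigma | exact: in_S_sigmaV].
have pos (n : nat) z : in_S (pt z y) <-> in_S (pt (z + n%:R * (phi * y)) y).
  elim: n => [|n IH]; first by rewrite mul0r addr0.
  by rewrite -natr1 mulrDl mul1r addrA -step.
case: m => n; first exact: pos.
by rewrite NegzE mulrNz mulNr (pos n.+1 (x - _)) subrK.
Qed.

Lemma in_S_vshear x y (m : nat) :
  in_S (pt x y) <-> in_S (pt x (y - m%:R * (phi * x))).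
Proof.
elim: m => [|m IH]; first by rewrite mul0r subr0.
rewrite IH; set z := _ - _; rewrite -natr1 mulrDl mul1r opprD addrA -/z.
have -> : pt x z = sigma R (inord 3) *m pt x (z - phi * x).
  by rewrite sigma3_pt addrC subrK.
by split; [exact: in_S_sigmaV | exact: in_S_sigma].
Qed.

(* The rotation is [sigma_0^-1 sigma_1 sigma_0^-1]. *)
Lemma in_S_rot x y : in_S (pt x y) -> in_S (pt (- y) x).
Proof.
move=> h; apply: (@in_S_sigmaV (inord 0)); rewrite sigma0_pt.
have -> : pt (- y + phi * x) x = sigma R (inord 1) *m pt (x - phi * y) y.
  rewrite sigma1_pt; have e := phi_sqr; congr pt; last by ring.
  by ring: e.
apply/in_S_sigma/(@in_S_shear _ _ 1).
by rewrite mul1r subrK.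
Qed.

(** * Fibonacci numbers and powers of [phi] *)

Lemma phi_fib n : phi ^+ n.+1 = phi * (fib n.+1)%:R + (fib n)%:R.
Proof.
elim: n => [|n IH]; first by rewrite expr1 /= mulr1 addr0.
by rewrite exprS IH fibSS natrD; have e := phi_sqr; ring: e.
Qed.

(** Conjugating [phi_fib] turns the first factor into minus an odd power of [1 - phi], which is
    [-1 / phi]; the two signs cancel. *)
Lemma fib_phi j :
  ((fib j.*2.+1)%:R * phi - (fib j.*2.+2)%:R) * phi ^+ j.*2.+1 = 1.
Proof.
have e := phi_sqr.
have conj n : (fib n.+1)%:R * phi - (fib n.+2)%:R = - (1 - phi) ^+ n.+1.
  elim: n => [|n IH]; first by rewrite expr1 /=; ring.
  by rewrite exprS -mulrN -IH (fibSS n.+1) natrD; ring: e.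
rewrite conj mulNr -exprMn (_ : (1 - phi) * phi = -1); last by ring: e.
by rewrite -signr_odd oddS odd_double expr1 opprK.
Qed.

Lemma fib_le_phi n : (fib n)%:R <= phi ^+ n.
Proof.
case: n => [|n]; first by rewrite expr0.
rewrite phi_fib -[leLHS]addr0 lerD // ler_peMl // ltW //.
exact: phi_gt1.
Qed.

(** * Explicit points of S *)

Lemma in_S_e2 : in_S (pt 0 1).
Proof. by have := in_S_rot _ _ in_S_e1; rewrite oppr0. Qed.

(* Both shears of the step use the digit [fib j.*2.+1]: it moves [fib j.*2] to
   [phi ^+ j.*2.+1], and then the inverse of that unit to [fib j.*2.+2]. *)
Lemma in_S_fib j :
  in_S (pt (phi ^+ (j ^ 2) * (fib j.*2)%:R) (phi ^+ (j ^ 2))).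
Proof.
elim: j => [|j IH]; first by rewrite expr0 mulr0; exact: in_S_e2.
have := in_S_rot _ _ IH; rewrite (in_S_vshear _ _ (fib j.*2.+1)).
rewrite (in_S_shear _ _ (fib j.*2.+1)).
have -> : (j.+1 ^ 2 = j ^ 2 + j.*2.+1)%N by lia.
have e1 := phi_fib j.*2; have e2 := fib_phi j.
rewrite doubleS exprD; set u := phi ^+ (j ^ 2).
set y := (X in in_S (pt _ X) -> _); have -> : y = u * phi ^+ j.*2.+1.
  by rewrite /y e1; ring.
set x := (X in in_S (pt X _) -> _).
suff -> : x = u * phi ^+ j.*2.+1 * (fib j.*2.+2)%:R by [].
have -> : x = - u * 1 + (fib j.*2.+1)%:R * (phi * (u * phi ^+ j.*2.+1)).
  by rewrite /x -pmulrn e1; ring.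
by rewrite -[X in - u * X]e2; ring.
Qed.

Lemma in_S_line_y1 (a : nat) : in_S (pt (- (2 * a%:R + 1) * phi) 1).
Proof.
have := in_S_e2; rewrite (in_S_shear _ _ (- (2 * a + 1)%N%:Z)).
by rewrite mulrNz -pmulrn natrD natrM add0r mulr1.
Qed.

(** The image of [pt 0 1] under [sigma_1] is [pt phi phi], and the rotation gives this point.
    Shearing it horizontally or vertically yields two of the three collinear points. *)
Lemma in_S_Nphi_phi : in_S (pt (- phi) phi).
Proof.
apply: in_S_rot.
by have := in_S_sigma (inord 1) _ in_S_e2; rewrite sigma1_pt mulr0 !add0r mulr1.
Qed.

Lemma in_S_line_yphi (a : nat) : in_S (pt (- a%:R * phi ^+ 2 - phi) phi).
Proof.
have := in_S_Nphi_phi; rewrite (in_S_shear _ _ (- a%:Z)) mulrNz -pmulrn.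
by rewrite addrC expr2.
Qed.

Lemma in_S_line_yphi3 : in_S (pt (- phi) (phi ^+ 3)).
Proof.
have := in_S_Nphi_phi; rewrite (in_S_vshear _ _ 1) mul1r.
suff -> : phi - phi * - phi = phi ^+ 3 by [].
by have e := phi_sqr; ring: e.
Qed.

(** Take [g] in Gamma sending [pt 1 0] to [u *: pt a 1]. The three collinear points pull back under
    [g] to a horizontal line, which a power of [sigma_0] preserves. *)
Lemma horizontal_triple (u : R) (a : nat)
    (y := u * (a%:R + (2 * a%:R + 1) * phi)) :
  0 < u -> in_S (pt (u * a%:R) u) ->
  exists2 x, 0 <= x <= phi * y &
    [/\ in_S (pt x y), in_S (pt (x + (phi - 1) / u) y)
      & in_S (pt (x + 2 * phi / u) y)].
Proof.
move=> u0 [g [gG gv]].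
have un0 : u != 0 by rewrite gt_eqF.
have [p pS gp] := Gamma_preimage _ _ gG (in_S_line_y1 a).
(* The height is the wedge of [pt 1 0] with [p], which [g] preserves, so it can be computed on the
   images. *)
have yp : ycoord p = y.
  have := wedge_mulmx g (pt 1 0) p.
  rewrite -gv gp det_Gamma // /wedge !xcoord_pt !ycoord_pt.
  by rewrite !mul1r mul0r subr0 => <-; rewrite /y; ring.
have y0 : 0 < y.
  have a0 : 0 <= a%:R :> R by [].
  have f0 := phi_gt0; rewrite /y mulr_gt0 // ltr_wpDl // mulr_gt0 //; lra.
(* A shift by [c *: pt a 1] is the image under [g] of a horizontal shift by [c / u]. *)
have other c q : in_S q -> q = g *m p + c *: pt a%:R 1 ->
    in_S (pt (xcoord p + c / u) y).
  move=> qS eq; have [r rS gr] := Gamma_preimage _ _ gG qS.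
  suff -> : pt (xcoord p + c / u) y = r by [].
  apply: (Gamma_inj _ gG); rewrite gr eq.
  have -> : pt (xcoord p + c / u) y = p + (c / u) *: pt 1 0.
    rewrite -{2}(pt_coords p) yp; apply/matrixP => i j; rewrite !mxE.
    by case: i => [[|[|]]] //= _; rewrite ?mulr1 ?mulr0 ?addr0.
  rewrite mulmxDr -scalemxAr -gv; congr (_ + _).
  apply/matrixP => i j; rewrite !mxE.
  by case: i => [[|[|]]] //= _; field.
(* Shearing by [- m] reduces the abscissa modulo [phi * y]. *)
pose m := Num.floor (xcoord p / (phi * y)).
have py0 : 0 < phi * y by rewrite mulr_gt0 ?phi_gt0.
have /andP[m1 m2] : m%:~R * (phi * y) <= xcoord p <= (m + 1)%:~R * (phi * y).
  have := floor_itv (xcoord p / (phi * y)); rewrite -/m.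
  by rewrite ler_pdivlMr // ltr_pdivrMr // => /andP[-> /ltW].
exists (xcoord p + (- m)%:~R * (phi * y)).
  rewrite mulrNz mulNr subr_ge0 m1 /=; move: m2.
  by rewrite intrD mulrDl mul1r lerBlDl.
split.
- by rewrite -(in_S_shear _ _ (- m)) -yp pt_coords.
- rewrite addrAC -(in_S_shear _ _ (- m)); apply: other (in_S_line_yphi a) _.
  rewrite gp; apply/matrixP => i j; rewrite !mxE; have e := phi_sqr.
  by case: i => [[|[|]]] //= _; ring: e.
- rewrite addrAC -(in_S_shear _ _ (- m)); apply: other in_S_line_yphi3 _.
  rewrite gp; apply/matrixP => i j; rewrite !mxE; have e := phi_sqr.
  by case: i => [[|[|]]] //= _; ring: e.
Qed.

Lemma pt_neq x y z : x != z -> pt x y != pt z y.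
Proof. by apply: contra_neq => /(congr1 (@xcoord R)); rewrite !xcoord_pt. Qed.

Lemma enorm_le x y : 0 <= x -> 0 <= y -> enorm (pt x y) <= x + y.
Proof.
move=> x0 y0; rewrite /enorm xcoord_pt ycoord_pt.
rewrite -[leRHS]ger0_norm ?addr_ge0 // -sqrtr_sqr ler_sqrt ?sqr_ge0 //.
by rewrite sqrrD addrAC lerDl mulrn_wge0 // mulr_ge0.
Qed.

End GoldenOrbit.

Theorem theorem1p6 (R : realType) :
  exists (eps : nat -> R) (C : R),
    (forall n, 0 < eps n) /\ eps @ \oo --> 0 /\ 0 < C /\
    forall n : nat, exists p1 p2 p3 : 'cV[R]_2,
      [/\ in_S p1, in_S p2 & in_S p3] /\
      [/\ p1 != p2, p1 != p3 & p2 != p3] /\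
      (exists a c : R,
         [/\ on_hseg a c (eps n) p1, on_hseg a c (eps n) p2
           & on_hseg a c (eps n) p3]) /\
      [/\ in_ball0 (C * (eps n) ^- 4) p1, in_ball0 (C * (eps n) ^- 4) p2
        & in_ball0 (C * (eps n) ^- 4) p3].
Proof.
have f1 := @phi_gt1 R; have f2 := @phi_lt2 R; have f0 := @phi_gt0 R.
have fX n : 1 <= phi R ^+ n by rewrite exprn_ege1 // ltW.
have fX0 n : 0 < phi R ^+ n by exact: lt_le_trans (fX n).
have sqn (n : nat) : (n <= n ^ 2)%N by nia.
(* This is the distance [2 * phi / u] between the outer two points of the triple. *)
pose eps n : R := 2 * phi R / phi R ^+ (n ^ 2).
have eps0 n : 0 < eps n by rewrite divr_gt0 ?mulr_gt0.
(* The factor [4 ^+ 4] comes from [u <= 4 / eps n]. The norm is at most [3 * y + eps n <= 36 * u ^+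
   2 + 4 <= 40 * u ^+ 4], and 41 makes the bound strict. *)
exists eps, (41 * 4 ^+ 4); split=> //; split; [|split=> // n].
  apply: (@squeeze_cvgr _ _ _ _ (cst 0) (geometric (2 * phi R) (phi R)^-1)).
  - near=> n; rewrite ltW //= /eps ler_pM2l ?mulr_gt0 // exprVn.
    by rewrite lef_pV2 ?posrE // ler_weXn2l ?ltW.
  - exact: cvg_cst.
  - by apply: cvg_geometric; rewrite ger0_norm ?invr_ge0 ?ltW // invf_lt1.
set u := phi R ^+ (n ^ 2).
have u1 : 1 <= u by exact: fX.
have u0 : 0 < u by exact: fX0.
have [x /andP[x0 xy] [S1 S2 S3]] := horizontal_triple R u _ u0 (in_S_fib R n).
set y := u * _ in xy S1 S2 S3.
(* The exponents compare because [2 n <= n ^ 2 + 1]. *)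
have a_le : (fib n.*2)%:R <= 2 * u.
  apply: le_trans (fib_le_phi R _) _; apply: le_trans (_ : phi R * u <= _).
    by rewrite -exprS ler_weXn2l ?ltW //; nia.
  by rewrite ler_pM2r // ltW.
have a0 : 0 <= (fib n.*2)%:R :> R by [].
have y0 : 0 <= y by rewrite /y mulr_ge0 ?addr_ge0 ?mulr_ge0 // ltW.
have y_le : y <= 12 * u ^+ 2.
  by rewrite /y expr2 (mulrCA 12) ler_pM2l //; nra.
have epsE : eps n = 2 * phi R / u by [].
have eps4 : u ^+ 4 <= 4 ^+ 4 * (eps n) ^- 4.
  have u_le : u <= 4 / eps n.
    by rewrite ler_pdivlMr // epsE mulrC divfK ?gt_eqF //; lra.
  rewrite -exprVn -exprMn lerXn2r ?nnegrE ?divr_ge0 ?(ltW u0) ?(ltW (eps0 n)) //.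
  by apply: mulr_ge0 => //; exact: ltW.
have ball z : 0 <= z -> z <= eps n ->
    in_ball0 (41 * 4 ^+ 4 * eps n ^- 4) (pt (x + z) y).
  move=> z0 ze; apply: le_lt_trans (enorm_le _ _ _ _ y0) _.
    by rewrite addr_ge0.
  have e4 : eps n <= 4.
    by rewrite epsE ler_pdivrMr //; nra.
  have u24 : u ^+ 2 <= u ^+ 4 by rewrite ler_weXn2l.
  have u2 : 1 <= u ^+ 2 by rewrite exprn_ege1.
  have x2 : x <= 2 * y by apply: le_trans xy _; rewrite ler_wpM2r // ltW.
  rewrite -mulrA; move: (4 ^+ 4 * _) eps4 => w eps4.
  move: (eps n) (u ^+ 2) (u ^+ 4) y ze x2 e4 y_le u24 u2 eps4 {y0 xy S1 S2 S3}.
  by move=> e v t {}y; lra.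
have d1 : 0 < (phi R - 1) / u by rewrite divr_gt0 ?subr_gt0.
have d2 : (phi R - 1) / u < eps n by rewrite epsE ltr_pM2r ?invr_gt0 //; lra.
have en0 := eps0 n.
exists (pt x y), (pt (x + (phi R - 1) / u) y), (pt (x + eps n) y).
split=> //; split; last split.
- by split; apply: pt_neq; rewrite lt_eqF // ?ltrDl ?ltrD2l.
- exists x, y; rewrite /on_hseg !xcoord_pt !ycoord_pt.
  by split; split; rewrite // ?lexx ?lerDl ?lerD2l !ltW.
- by split; [rewrite -[x]addr0 | | ]; apply: ball; rewrite ?lexx ?ltW.
Unshelve. all: by end_near.
Qed.
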